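(* For every composition $\alpha\models n$, $$\boldsymbol{h}_\alpha=\sum_{W\in\mathcal{IW}_\alpha}\frac{1}{\mathrm{fb}(W)}\frac{\boldsymbol{\phi}_{\mathrm{type}(W)}}{z_{\mathrm{type}(W)}},\qquad \boldsymbol{e}_\alpha=\sum_{W\in\mathcal{IW}_\alpha}\frac{(-1)^{|\mathrm{sh}(W)|-\ell(\mathrm{type}(W))}}{\mathrm{fb}(W)}\frac{\boldsymbol{\phi}_{\mathrm{type}(W)}}{z_{\mathrm{type}(W)}},$$ $$\phi_\alpha=\sum_{W\in\mathcal{IW}^\alpha}\frac{1}{\mathrm{fb}(W)}M_{\mathrm{sh}(W)},\qquad \phi_\alpha=\sum_{W\in\mathcal{IW}^\alpha}\frac{(-1)^{|\mathrm{sh}(W)|-\ell(\mathrm{type}(W))}}{\mathrm{fb}(W)}\mathrm{For}_{\mathrm{sh}(W)}.$$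
   Context: For a composition $\alpha=(\alpha_1,\dots,\alpha_\ell)\models n$: $|\alpha|=n$, $\ell(\alpha)=\ell$, $\mathrm{set}(\alpha)=\{\alpha_1,\dots,\alpha_1+\cdots+\alpha_{\ell-1}\}$, $\alpha^c$ the composition with $\mathrm{set}(\alpha^c)=[n-1]\setminus\mathrm{set}(\alpha)$; $\beta\preceq\alpha$ iff $\mathrm{set}(\beta)\supseteq\mathrm{set}(\alpha)$, in which case $\beta$ splits into consecutive blocks $\beta^{(1)},\dots,\beta^{(\ell(\alpha))}$ with $|\beta^{(i)}|=\alpha_i$. $m_i(\alpha)$ = number of parts equal to $i$, and $z_\alpha=\prod_i i^{m_i(\alpha)}m_i(\alpha)!$. Walls: for $\beta\preceq\alpha$, the $\alpha\beta$-wall is the diagram with rows of lengths $\alpha_1,\alpha_2,\dots$ (bottom to top), row $i$ filled left to right by bricks (horizontal strips) of lengths given by $\beta^{(i)}$; it has shape $\mathrm{sh}(W)=\alpha$, type $\mathrm{type}(W)=\beta$. An indexed $\alpha\beta$-wall is a bijective labelling of its bricks by $1,\dots,\ell(\beta)$ with labels increasing with brick size (equal-size bricks labelled in any order). $\mathcal{IW}_\alpha$ is the set of all indexed walls of shape $\alpha$, $\mathcal{IW}^\beta$ the set of all indexed walls of type $\beta$. For such $W$, $\mathrm{fb}(W)=\prod_{i=1}^{\ell(\alpha)}\ell(\beta^{(i)})!$. Noncommutative side ($\boldsymbol{x}_i$ noncommuting): $\boldsymbol{r}_\alpha=\sum\boldsymbol{x}_{i_1}\cdots\boldsymbol{x}_{i_n}$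 over $I\in(\mathbb{Z}^+)^n$ with $\{j:i_j>i_{j+1}\}=\mathrm{set}(\alpha)$; $\boldsymbol{e}_n=\sum_{i_1>\cdots>i_n\ge1}\boldsymbol{x}_{i_1}\cdots\boldsymbol{x}_{i_n}$, $\boldsymbol{h}_n=\sum_{1\le i_1\le\cdots\le i_n}\boldsymbol{x}_{i_1}\cdots\boldsymbol{x}_{i_n}$, $\boldsymbol{\phi}_n=\sum_{\gamma\models n}\frac{(-1)^{\ell(\gamma)-1}}{\binom{n-1}{\ell(\gamma)-1}}\boldsymbol{r}_\gamma$, all extended multiplicatively over parts. Quasisymmetric side (commuting $x_i$): $M_\alpha=\sum_{i_1<\cdots<i_\ell}x_{i_1}^{\alpha_1}\cdots x_{i_\ell}^{\alpha_\ell}$, $F_\alpha=\sum x_{i_1}\cdots x_{i_n}$ over $i_1\le\cdots\le i_n$ with $i_k<i_{k+1}$ for $k\in\mathrm{set}(\alpha)$; $\psi$ is the linear map on QSym with $\psi(F_\alpha)=F_{\alpha^c}$, and $\mathrm{For}_\alpha=\psi(M_\alpha)$. The bilinear pairing $\langle\cdot,\cdot\rangle:\mathrm{QSym}\times\mathbf{NSym}\to\mathbb{C}$ is defined by $\langle F_\alpha,\boldsymbol{r}_\beta\rangle=\mathbbm{1}_{\alpha=\beta}$, and $\{\phi_\alpha\}$ is the basis of QSym determined by $\langle\phi_\alpha,\boldsymbol{\phi}_\beta\rangle=z_\alpha\mathbbm{1}_{\alpha=\beta}$. *)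

(* Defs.v *)
From HB Require Import structures.
From mathcomp Require Import all_boot all_order all_algebra all_fingroup.
Set Implicit Arguments. Unset Strict Implicit. Unset Printing Implicit Defensive.
Import Order.TTheory GRing.Theory Num.Theory.
Local Open Scope ring_scope.

Definition pos (w : seq nat) : bool := all (fun i => 0 < i)%N w.
Definition is_comp (a : seq nat) : bool := pos a.

Fixpoint comps_rec (fuel n : nat) : seq (seq nat) :=
  match n with
  | 0 => [:: [::]]
  | _ => match fuel with
         | 0 => [::]
         | f.+1 => flatten [seq [seq k :: c | c <- comps_rec f (n - k)] | k <- iota 1 n]
         end
  end.
Definition compositions (n : nat) : seq (seq nat) := comps_rec n n.

Definition setc (a : seq nat) : seq nat :=
  [seq sumn (take k a) | k <- iota 1 (size a).-1].

(* composition of n with set equal to the increasing list S of [n-1] *)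
Definition comp_of_set (n : nat) (S : seq nat) : seq nat :=
  match n with
  | 0 => [::]
  | _ => let pts := 0%N :: rcons S n in
         [seq (p.2 - p.1)%N | p <- zip pts (behead pts)]
  end.

Definition compl (a : seq nat) : seq nat :=
  comp_of_set (sumn a) [seq i <- iota 1 (sumn a).-1 | i \notin setc a].

Definition zc (a : seq nat) : nat :=
  (\prod_(i <- undup a) (i ^ count_mem i a * (count_mem i a)`!))%N.

(* Walls.  A wall of shape alpha is the list B of its rows (bottom to   *)
(* top), row i being the composition beta^(i) |= alpha_i of its brick   *)
(* lengths (left to right).  Bricks are numbered row by row, i.e. by    *)
(* their position in flatten B.                                         *)
Definition walls (a : seq nat) : seq (seq (seq nat)) :=
  foldr (fun k acc => [seq c :: rest | c <- compositions k, rest <- acc])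
        [:: [::]] a.
Definition wshape (B : seq (seq nat)) : seq nat := map sumn B.
Definition wtype (B : seq (seq nat)) : seq nat := flatten B.
Definition fb (B : seq (seq nat)) : nat := (\prod_(b <- B) (size b)`!)%N.

(* an indexing: bijective labelling of the bricks (labels 0..l-1),
   increasing with brick size *)
Definition lab_ok (b : seq nat) (s : {perm 'I_(size b)}) : bool :=
  [forall j : 'I_(size b), forall k : 'I_(size b),
      (nth 0 b j < nth 0 b k)%N ==> (s j < s k)%N].

Section Series.
Variable R : numFieldType.

Definition IWsum_shape (a : seq nat) (F : seq (seq nat) -> R) : R :=
  \sum_(B <- walls a)
     \sum_(s : {perm 'I_(size (wtype B))} | lab_ok s) F B.

Definition IWsum_type (b : seq nat) (F : seq (seq nat) -> R) : R :=
  \sum_(g <- compositions (sumn b))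
    \sum_(B <- walls g | wtype B == b)
      \sum_(s : {perm 'I_(size (wtype B))} | lab_ok s) F B.

(* a noncommutative formal power series in x_1, x_2, ...: the function
   giving the coefficient of the word x_{w_1} ... x_{w_k} *)
Definition ncs := seq nat -> R.

Definition rib (a : seq nat) : ncs := fun w =>
  ((size w == sumn a) && pos w &&
   ([seq j <- iota 1 (size w).-1 | nth 0 w j < nth 0 w j.-1]%N == setc a))%:R.
Definition hn (n : nat) : ncs := fun w =>
  ((size w == n) && pos w && sorted leq w)%:R.
Definition en (n : nat) : ncs := fun w =>
  ((size w == n) && pos w && sorted (fun x y => y < x)%N w)%:R.
Definition ncone : ncs := fun w => (w == [::])%:R.
Definition ncmul (f g : ncs) : ncs := fun w =>
  \sum_(k < (size w).+1) f (take k w) * g (drop k w).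
Definition ncprod (f : nat -> ncs) (a : seq nat) : ncs :=
  foldr (fun k acc => ncmul (f k) acc) ncone a.
Definition phin (n : nat) : ncs := fun w =>
  \sum_(g <- compositions n)
     ((-1) ^+ (size g).-1 / ('C(n.-1, (size g).-1))%:R) * rib g w.

Definition hA := ncprod hn.
Definition eA := ncprod en.
Definition phiA := ncprod phin.

(* a commutative formal power series: the function giving the coefficient
   of the monomial x_{w_1} ... x_{w_k}, the word w being weakly increasing
   (non-sorted words represent no monomial, coefficient 0) *)
Definition cs := seq nat -> R.

Definition Mmon (a : seq nat) : cs := fun w =>
  (#|[pred j : (size a).-tuple 'I_((\max_(i <- w) i)%N.+1) |
       sorted ltn (map val j) && pos (map val j) &&
       (flatten [seq nseq p.1 p.2 | p <- zip a (map val j)] == w)]|)%:R.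
Definition Fmon (a : seq nat) : cs := fun w =>
  ((size w == sumn a) && pos w && sorted leq w &&
   all (fun k => nth 0 w k.-1 < nth 0 w k)%N (setc a))%:R.

Definition Fexp (d : seq nat -> R) (n : nat) : cs := fun w =>
  \sum_(g <- compositions n) d g * Fmon g w.
Definition rexp (c : seq nat -> R) (n : nat) : ncs := fun w =>
  \sum_(g <- compositions n) c g * rib g w.

(* < sum d_g F_g , sum c_g r_g > (bilinear, <F_a, r_b> = [a = b]) *)
Definition pairing (d c : seq nat -> R) (n : nat) : R :=
  \sum_(g <- compositions n) d g * c g.

(* f = sum_{g |= |a|} d_g F_g is phi_a: <f, phi_b> = z_a [a = b] for all b |= |a| *)
Definition is_phi_dual (a : seq nat) (d : seq nat -> R) : Prop :=
  forall b, b \in compositions (sumn a) ->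
  forall c : seq nat -> R, (forall w, phiA b w = rexp c (sumn b) w) ->
  pairing d c (sumn a) = (zc a)%:R * (a == b)%:R.

Definition is_M_Fexp (e : seq nat -> seq nat -> R) : Prop :=
  forall g, is_comp g -> forall w, Mmon g w = Fexp (e g) (sumn g) w.

(* For_g = psi(M_g) = sum_d (e g d) F_{d^c} *)
Definition For (e : seq nat -> seq nat -> R) (g : seq nat) : cs := fun w =>
  \sum_(dl <- compositions (sumn g)) e g dl * Fmon (compl dl) w.

End Series.

(* Main.v *)
(** The coefficient of a word [w] with [d] descents in the [t]-th power of the
    generating series [H] of the [h_n] is [binomial (t - 1 - d + |w|) |w|], a
    polynomial in [t] whose linear coefficient is that of [phi_n / n].  From
    [H^(s + t) = H^s H^t] one gets a differential equation whose solution is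
    [H^t = exp (t * sum_n phi_n / n)].  Evaluating at [t = 1] and [t = -1]
    expands [h_n] and [(-1)^n e_n] in products of the [phi_k]; the number of
    indexings of a wall of type [beta] is [z_beta] divided by the product of the
    parts of [beta], so multiplying over rows gives the first two identities.

    The coefficient of [M_gamma] in [phi_alpha] is the pairing of [phi_alpha]
    with [h_gamma], which the first identity computes.  Reversing all descents of
    a word multiplies the coefficient of [phi_beta] by
    [(-1)^(|beta| - l(beta))]; hence [phi_alpha] is an eigenvector of [psi], and
    applying [psi] to the [M]-expansion gives the [For]-expansion. *)

Require Import Defs.
From HB Require Import structures.
From mathcomp Require Import all_boot all_order all_algebra all_fingroup.
From mathcomp Require Import zify ring.
Set Implicit Arguments. Unset Strict Implicit. Unset Printing Implicit Defensive.
Import Order.TTheory GRing.Theory Num.Theory.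
Local Open Scope ring_scope.

(** * Convolution of words and compositions *)

Lemma pos_cat u v : pos (u ++ v) = pos u && pos v.
Proof. exact: all_cat. Qed.

Lemma pos_take_drop k w : pos w = pos (take k w) && pos (drop k w).
Proof. by rewrite -pos_cat cat_take_drop. Qed.

Lemma size_le_sumn a : pos a -> (size a <= sumn a)%N.
Proof. by elim: a => //= x a IH /andP [x0 /IH]; lia. Qed.

Section Convolution.
Variable R : numFieldType.
Implicit Types f g h : ncs R.

Lemma eq_ncmul f f' g g' w :
  f =1 f' -> g =1 g' -> ncmul f g w = ncmul f' g' w.
Proof. by move=> ef eg; apply: eq_bigr => k _; rewrite ef eg. Qed.

Lemma ncmul_nil f g : ncmul f g [::] = f [::] * g [::].
Proof. by rewrite /ncmul big_ord_recl big_ord0 addr0. Qed.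

Lemma ncmul_cons f g x w :
  ncmul f g (x :: w) = f [::] * g (x :: w) + ncmul (fun v => f (x :: v)) g w.
Proof. by rewrite /ncmul big_ord_recl. Qed.

Lemma ncmulDl f f' g w :
  ncmul (fun v => f v + f' v) g w = ncmul f g w + ncmul f' g w.
Proof. by rewrite -big_split; apply: eq_bigr => k _; rewrite mulrDl. Qed.

Lemma ncmulZl c f g w : ncmul (fun v => c * f v) g w = c * ncmul f g w.
Proof. by rewrite /ncmul big_distrr; apply: eq_bigr => k _ /=; rewrite mulrA. Qed.

(** Induction on the word for all series at once: removing the first letter [x] replaces the left
    factor by [fun v => f (x :: v)], so no double sum over pairs of cuts has to be reindexed. *)
Lemma ncmulA f g h w : ncmul (ncmul f g) h w = ncmul f (ncmul g h) w.
Proof.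
elim: w f g h => [|x w IH] f g h; first by rewrite !ncmul_nil mulrA.
rewrite !ncmul_cons ncmul_nil.
rewrite (@eq_ncmul _ (fun v => f [::] * g (x :: v)
          + ncmul (fun u => f (x :: u)) g v) _ h) //; last first.
  by move=> v; rewrite ncmul_cons.
by rewrite ncmulDl ncmulZl IH mulrDr mulrA addrA.
Qed.

Lemma ncmul1 f w : ncmul (ncone R) f w = f w.
Proof.
case: w => [|x w]; first by rewrite ncmul_nil /ncone eqxx mul1r.
rewrite ncmul_cons /ncone eqxx mul1r /ncmul big1 ?addr0 // => k _.
by rewrite mul0r.
Qed.

(** A left factor supported on words of length [k] leaves only the cut at [k], and no cut at all
    when the word is shorter. *)
Lemma ncmul_homog k f g w :
  (forall v, size v != k -> f v = 0) ->
  ncmul f g w = (k <= size w)%N%:R * (f (take k w) * g (drop k w)).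
Proof.
move=> f0; case: leqP => kw; last first.
  rewrite mul0r /ncmul big1 // => i _; rewrite f0 ?mul0r // size_take.
  by have := ltn_ord i; case: ifP; lia.
have kw' : (k < (size w).+1)%N by [].
rewrite mul1r /ncmul (bigD1 (Ordinal kw')) //= big1 ?addr0 // => i ik.
rewrite f0 ?mul0r // size_takel; last by have := ltn_ord i; lia.
by apply: contra ik => /eqP ik; apply/eqP/val_inj.
Qed.

Lemma ncprod_cat (F : nat -> ncs R) a b w :
  ncprod F (a ++ b) w = ncmul (ncprod F a) (ncprod F b) w.
Proof.
elim: a w => [|k a IH] w /=; first by rewrite ncmul1.
by rewrite ncmulA; apply: eq_ncmul.
Qed.

Lemma ncprod_homog (F : nat -> ncs R) a w :
  (forall k v, size v != k -> F k v = 0) ->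
  size w != sumn a -> ncprod F a w = 0.
Proof.
move=> F0; elim: a w => [|k a IH] w /= sw.
  by rewrite /ncone; case: w sw.
rewrite (ncmul_homog _ _ (F0 k)); case: leqP => kw; last by rewrite mul0r.
by rewrite IH ?mulr0 // size_drop; apply: contra sw; lia.
Qed.

End Convolution.

(** * Enumeration of compositions *)

Lemma comps_rec_fuel f n : (n <= f)%N -> comps_rec f n = compositions n.
Proof.
rewrite /compositions; elim/ltn_ind: n f => -[|n] IH [|f] // nf.
rewrite /comps_rec -/comps_rec.
congr flatten; apply/eq_in_map => k; rewrite mem_iota => kn.
by rewrite IH; [rewrite [in RHS]IH //; lia | lia | lia].
Qed.

Lemma compositionsS n :
  compositions n.+1 =
  flatten [seq [seq k :: c | c <- compositions (n.+1 - k)] | k <- iota 1 n.+1].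
Proof.
rewrite {1}/compositions /comps_rec -/comps_rec.
congr flatten; apply/eq_in_map => k; rewrite mem_iota => kn.
by rewrite comps_rec_fuel //; lia.
Qed.

Lemma mem_compositions n g : (g \in compositions n) = pos g && (sumn g == n).
Proof.
elim/ltn_ind: n g => -[|n] IH g.
  rewrite /compositions /= inE; case: g => //= x g.
  by apply/esym/negbTE; apply/negP; lia.
rewrite compositionsS; apply/flattenP/idP => [[s /mapP [k]]|].
  rewrite mem_iota => kn -> /mapP [c]; rewrite IH; last by lia.
  by move=> /andP [pc /eqP sc] -> /=; rewrite pc sc; lia.
case: g => // x g /andP [/andP [x0 pg] /eqP sg]; rewrite /= in x0 sg.
have {}pg : pos g by [].
exists [seq x :: c | c <- compositions (n.+1 - x)].
  by apply/mapP; exists x; rewrite // mem_iota; lia.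
by apply: map_f; rewrite IH ?pg; lia.
Qed.

Lemma uniq_compositions n : uniq (compositions n).
Proof.
elim/ltn_ind: n => -[|n] IH //; rewrite compositionsS.
apply: (@allpairs_uniq_dep nat (fun=> seq nat) (seq nat) (fun k c => k :: c)).
- exact: iota_uniq.
- by move=> k; rewrite mem_iota => kn; apply: IH; lia.
- by move=> [k c] [k' c'] /= _ _ [-> ->].
Qed.

Lemma big_compositionsS (V : nmodType) n (P : pred (seq nat)) (F : seq nat -> V) :
  \sum_(b <- compositions n.+1 | P b) F b =
  \sum_(k < n.+1) \sum_(c <- compositions (n - k) | P (k.+1 :: c)) F (k.+1 :: c).
Proof.
rewrite compositionsS big_flatten big_map -[in iota _ _](addn0 1%N) iotaDl big_map.
rewrite -/(index_iota 0 n.+1) big_mkord /=; apply: eq_bigr => k _.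
by rewrite big_map /= subSS.
Qed.

Lemma phin_homog (R : numFieldType) k w : size w != k -> phin R k w = 0.
Proof.
move=> sw; rewrite /phin big_seq big1 // => g.
rewrite mem_compositions => /andP [_ /eqP gk].
by rewrite /rib gk (negbTE sw) mulr0.
Qed.

(** * Descents of a word *)

Definition desc (w : seq nat) : seq nat :=
  [seq j <- iota 1 (size w).-1 | nth 0 w j < nth 0 w j.-1]%N.

Lemma mem_desc w j :
  (j \in desc w) = (0 < j < size w)%N && (nth 0 w j < nth 0 w j.-1)%N.
Proof. by rewrite mem_filter mem_iota andbC; congr andb; lia. Qed.

Lemma desc_sorted w : sorted ltn (desc w).
Proof. by apply: (sorted_filter ltn_trans); apply: iota_ltn_sorted. Qed.

Lemma size_desc_cons x y u :
  size (desc (x :: y :: u)) = ((y < x)%N + size (desc (y :: u)))%N.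
Proof.
rewrite !size_filter /= -[in iota 2 _](addn1 1%N) iotaDl count_map; congr addn.
by apply: eq_in_count => i; rewrite mem_iota /=; case: i.
Qed.

Lemma size_desc_lt w : w != [::] -> (size (desc w) < size w)%N.
Proof.
case: w => // x w _; rewrite size_filter.
by have := count_size (fun j => nth 0 (x :: w) j < nth 0 (x :: w) j.-1)%N
  (iota 1 (size w)); rewrite size_iota.
Qed.

Lemma sorted_leq_desc w : sorted leq w = (size (desc w) == 0)%N.
Proof.
elim: w => [|x [|y u] IH] //; rewrite size_desc_cons /= in IH *.
by rewrite IH; case: ltnP; rewrite ?add0n.
Qed.

Lemma sorted_gt_desc w :
  sorted (fun x y => y < x)%N w = (size (desc w) == (size w).-1)%N.
Proof.
elim: w => [|x [|y u] IH] //; have := @size_desc_lt (y :: u) isT.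
rewrite size_desc_cons; move: IH; move: (size (desc _)) => d /= ->.
by case: (ltnP y x) => _; lia.
Qed.

(** * Powers of the series H *)

Section HPower.
Variable R : numFieldType.

Lemma factR_neq0 n : n`!%:R != 0 :> R.
Proof. by rewrite pnatr_eq0 -lt0n fact_gt0. Qed.

(** The natural numbers are distinct in [R], so a nonzero difference would have more roots than its
    degree allows. *)
Lemma poly_eq_on_nat (p q : {poly R}) :
  (forall m : nat, p.[m%:R] = q.[m%:R]) -> p = q.
Proof.
move=> pq; apply/eqP; rewrite -subr_eq0; apply/negPn/negP => nz.
pose rs := [seq m%:R : R | m <- iota 0 (size (p - q))].
have := max_poly_roots nz (rs := rs); rewrite size_map size_iota ltnn.
have -> : all (root (p - q)) rs.
  by apply/allP => _ /mapP [m _ ->]; rewrite rootE !hornerE pq subrr.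
have -> : uniq rs.
  by rewrite map_inj_uniq ?iota_uniq // => i j /eqP; rewrite eqr_nat => /eqP.
by move=> /(_ isT isT).
Qed.

Definition rising (n : nat) (t : R) : R := \prod_(i < n) (t + i%:R).

Lemma risingS n t : rising n.+1 t = rising n t * (t + n%:R).
Proof. by rewrite /rising big_ord_recr. Qed.

Lemma risingSl n t : rising n.+1 t = t * rising n (t + 1).
Proof.
rewrite /rising big_ord_recl addr0; congr (_ * _); apply: eq_bigr => i _.
by rewrite lift0 -natr1 -addrA [1 + _]addrC.
Qed.

(* The coefficient of the word [w] in the [t]-th power of the sum of all [h_n]
   is [binomial (t - 1 - des w + size w) (size w)], a polynomial in [t]. *)
Definition hpow (w : seq nat) : {poly R} :=
  ((pos w)%:R / (size w)`!%:R) *: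
    \prod_(i < size w) ('X + (i%:R - (size (desc w))%:R)%:P).

Lemma hpowE w t :
  (hpow w).[t] =
  (pos w)%:R / (size w)`!%:R * rising (size w) (t - (size (desc w))%:R).
Proof.
rewrite /hpow hornerZ horner_prod; congr (_ * _); apply: eq_bigr => i _.
by rewrite hornerD hornerX hornerC addrA addrAC.
Qed.

Lemma hpow_size w : (size (hpow w) <= (size w).+1)%N.
Proof.
apply: leq_trans (size_scale_leq _ _) _.
rewrite (eq_bigr (fun i : 'I__ => 'X - ((size (desc w))%:R - i%:R)%:P)).
  by rewrite size_prod_XsubC; rewrite /index_enum -enumT size_enum_ord.
by move=> i _; rewrite -opprB polyCN.
Qed.

(** Pascal's rule for [binomial (t + 1 - d + n) (n + 1)], where [w] has [n] letters and [d]
    descents; [hpow_step_desc] is the same rule with one more descent. *)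
Lemma hpow_step (w : seq nat) (x : nat) (t : R) : (0 < x)%N ->
  size (desc (x :: w)) = size (desc w) ->
  (hpow (x :: w)).[t + 1] = (hpow (x :: w)).[t] + (hpow w).[t + 1].
Proof.
move=> x0 dw; rewrite !hpowE dw /= -/(pos w) x0 /= risingS.
set d := (size _)%:R.
have -> : t + 1 - d = t - d + 1 by ring.
rewrite risingSl factS natrM.
have := factR_neq0 (size w); have : (size w).+1%:R != 0 :> R by rewrite pnatr_eq0.
by rewrite -natr1 => n0 f0; field; rewrite f0 n0.
Qed.

Lemma hpow_step_desc (w : seq nat) (x : nat) (t : R) : (0 < x)%N ->
  size (desc (x :: w)) = (size (desc w)).+1 ->
  (hpow (x :: w)).[t + 1] = (hpow (x :: w)).[t] + (hpow w).[t].
Proof.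
move=> x0 dw; rewrite !hpowE dw /= -/(pos w) x0 /= risingS -natr1.
set d := (size _)%:R.
have -> : t + 1 - (d + 1) = t - d by ring.
have -> : t - d = t - (d + 1) + 1 by ring.
rewrite risingSl factS natrM.
have := factR_neq0 (size w); have : (size w).+1%:R != 0 :> R by rewrite pnatr_eq0.
by rewrite -natr1 => n0 f0; field; rewrite f0 n0.
Qed.

Definition incr (w : seq nat) : R := (pos w && sorted leq w)%:R.

(** This is [H * H^t = H^(t + 1)]. The empty prefix gives the first term of Pascal's rule. If
    [x <= y], a nonempty increasing prefix is [x] followed by an increasing prefix of the rest,
    which the induction hypothesis sums; after a descent only the prefix [x] survives. *)
Lemma ncmul_incr_hpow t w :
  ncmul incr (fun v => (hpow v).[t]) w = (hpow w).[t + 1].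
Proof.
elim: w => [|x w IH].
  by rewrite ncmul_nil !hpowE /rising !big_ord0 /incr mul1r.
rewrite ncmul_cons {1}/incr mul1r.
case: (posnP x) => x0.
  rewrite !hpowE x0 /= !mul0r /ncmul big1 ?addr0 // => k _.
  by rewrite /incr mul0r.
case: w IH => [|y u] IH.
  rewrite ncmul_nil /incr /= x0 mul1r.
  by rewrite hpow_step ?hpowE // /rising !big_ord0.
case: (leqP x y) => xy.
  rewrite hpow_step // ?size_desc_cons 1?ltnNge ?xy // -IH !ncmul_cons.
  congr (_ + (_ + _)); first by rewrite /incr /= x0.
  by apply: eq_bigr => k _; rewrite /incr /= x0 xy.
rewrite hpow_step_desc // ?size_desc_cons ?xy // ncmul_cons; congr (_ + _).
rewrite {1}/incr /= x0 mul1r /ncmul big1 ?addr0 // => k _.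
by rewrite /incr /= (leqNgt x y) xy !andbF mul0r.
Qed.

(** A nonempty word has fewer descents than letters, so the factor whose index is the number of
    descents occurs and vanishes at [0]. *)
Lemma hpow0 w : (hpow w).[0] = ncone R w.
Proof.
rewrite hpowE /ncone; case: w => [|x w].
  by rewrite /rising big_ord0 /= divr1 mulr1.
have dw := @size_desc_lt (x :: w) isT.
by rewrite /rising (bigD1 (Ordinal dw)) //= add0r addNr mul0r mulr0.
Qed.

Lemma hpow_add (s m : nat) w :
  (hpow w).[s%:R + m%:R] =
  ncmul (fun v => (hpow v).[s%:R]) (fun v => (hpow v).[m%:R]) w.
Proof.
elim: s w => [|s IH] w.
  rewrite add0r -[LHS](ncmul1 (fun v => (hpow v).[m%:R])).
  by apply: eq_ncmul => // v; rewrite hpow0.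
rewrite -natr1 addrAC -ncmul_incr_hpow (eq_ncmul _ (fun=> erefl) IH) -ncmulA.
by apply: eq_ncmul => // v; rewrite ncmul_incr_hpow.
Qed.

(** The differential equation of [H^t]: it is [H^(s + t) = H^s H^t] differentiated in [s] at [0]. *)
Lemma deriv_hpow w :
  (hpow w)^`() =
  \sum_(k < (size w).+1) (hpow (take k w))`_1 *: hpow (drop k w).
Proof.
apply: poly_eq_on_nat => m.
(* For fixed [m] the addition law holds at every natural [s], hence as an identity of polynomials in
   [s], which may be differentiated. *)
have /(congr1 (fun p : {poly R} => p^`().[0])) :
    hpow w \Po ('X + m%:R%:P) =
    \sum_(k < (size w).+1) (hpow (drop k w)).[m%:R] *: hpow (take k w).
  apply: poly_eq_on_nat => s.
  rewrite horner_comp hornerD hornerX hornerC hpow_add horner_sum.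
  by apply: eq_bigr => k _; rewrite hornerZ mulrC.
rewrite deriv_comp derivD derivX derivC addr0 mulr1 horner_comp !hornerE.
move=> ->; rewrite raddf_sum /= !horner_sum; apply: eq_bigr => k _.
by rewrite derivZ !hornerZ mulrC horner_coef0 coef_deriv.
Qed.

Lemma coef_hpowS w j :
  (hpow w)`_j.+1 *+ j.+1 =
  ncmul (fun v => (hpow v)`_1) (fun v => (hpow v)`_j) w.
Proof.
rewrite -coef_deriv deriv_hpow coef_sum.
by apply: eq_bigr => k _; rewrite coefZ.
Qed.

End HPower.

(** * Descent sets and the linear coefficient *)

Lemma scanl_addn x a :
  scanl addn x a = [seq x + sumn (take k a) | k <- iota 1 (size a)]%N.
Proof.
elim: a x => //= y a IH x; rewrite take0 /= addn0 IH; congr cons.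
rewrite -[in iota 2 _](addn1 1%N) iotaDl -map_comp.
by apply: eq_map => k /=; rewrite addnA.
Qed.

(** Rewrites the partial sums as a [scanl], the inverse of the [pairmap] of differences behind
    [comp_of_set]. *)
Lemma rcons_setc a : a != [::] -> rcons (setc a) (sumn a) = scanl addn 0%N a.
Proof.
case: a => // x a _; rewrite scanl_addn /setc -[(size _).-1]/(size a).
rewrite [size (x :: a)]/= -[(size a).+1]addn1 iotaD map_cat -cats1.
by congr cat; rewrite /= take_size.
Qed.

Lemma size_setc a : size (setc a) = (size a).-1.
Proof. by rewrite size_map size_iota. Qed.

Lemma comp_of_setE n S : (0 < n)%N ->
  comp_of_set n S = pairmap (fun x y => y - x)%N 0%N (rcons S n).
Proof.
case: n => // n _; rewrite /comp_of_set /=; move: (rcons S _) 0%N => s.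
by elim: s => //= y s IH x; rewrite IH.
Qed.

Lemma setcK a : pos a -> comp_of_set (sumn a) (setc a) = a.
Proof.
case: a => [|x a] // /andP [/= x0 _]; rewrite comp_of_setE /=; last by lia.
by rewrite (@rcons_setc (x :: a)) // (scanlK (g := addn)) // => u v; rewrite addKn.
Qed.

Lemma sumn_pairmap_subn x s :
  path leq x s -> sumn (pairmap (fun u v => v - u)%N x s) = (last x s - x)%N.
Proof.
elim: s x => [|y s IH] x /=; first by rewrite subnn.
move=> /andP [xy ys]; rewrite IH //.
have : (y <= last y s)%N.
  by have := order_path_min leq_trans ys; case/lastP: s {IH ys} => // s z;
    rewrite last_rcons all_rcons => /andP [].
by lia.
Qed.

Lemma scanl_pairmap_subn x s :
  path leq x s -> scanl addn x (pairmap (fun u v => v - u)%N x s) = s.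
Proof. by elim: s x => //= y s IH x /andP [xy ys]; rewrite subnKC // IH. Qed.

Definition valid_set (n : nat) (S : seq nat) : bool :=
  sorted ltn S && all (fun j => 0 < j < n)%N S.

(** The end points [0] and [n] merge the ordering and the bounds into one strict chain, the form
    that suits successive differences. *)
Lemma valid_set_path n S :
  (0 < n)%N -> valid_set n S = path ltn 0%N (rcons S n).
Proof.
move=> n0; rewrite rcons_path /valid_set (path_sortedE ltn_trans).
case/lastP: S => [|S x] /=; first by rewrite n0.
rewrite last_rcons !all_rcons; apply/andP/andP.
  case=> sS /andP [/andP [x0 xn] aS]; split=> //; rewrite x0 sS andbT.
  by apply/allP => y /(allP aS) /andP [].
case=> /andP [/andP [x0 aS] sS] xn; split=> //; rewrite x0 xn.
apply/allP => y yS; rewrite (allP aS _ yS).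
move: sS; rewrite (sorted_pairwise ltn_trans) pairwise_rcons.
by case/andP => /allP /(_ _ yS) /= yx _; rewrite (ltn_trans yx xn).
Qed.

Lemma valid_setc a : pos a -> valid_set (sumn a) (setc a).
Proof.
case: a => // x a p; have n0 : (0 < sumn (x :: a))%N by case/andP: p => /=; lia.
rewrite valid_set_path // rcons_setc // {n0}.
elim: (x :: a) 0%N p => {x a} //= x a IH y /andP [x0 pa].
by rewrite IH // andbT; lia.
Qed.

Lemma valid_desc w : valid_set (size w) (desc w).
Proof.
by rewrite /valid_set desc_sorted; apply/allP => j; rewrite mem_desc => /andP [].
Qed.

Lemma comp_of_set_mem n S : valid_set n S -> comp_of_set n S \in compositions n.
Proof.
case: (posnP n) => [-> //|n0]; rewrite valid_set_path // => pS.
rewrite mem_compositions comp_of_setE // sumn_pairmap_subn; last first.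
  by apply: sub_path pS => i j /ltnW.
rewrite last_rcons subn0 eqxx andbT.
by elim: (rcons _ _) {n0} 0%N pS => //= y s IH x /andP [xy /IH ->]; rewrite subn_gt0 xy.
Qed.

Lemma comp_of_setK n S : valid_set n S -> setc (comp_of_set n S) = S.
Proof.
case: (posnP n) => [->|n0].
  by case: S => //= x S /andP [_ /andP [/andP []]]; lia.
move=> vS; have := comp_of_set_mem vS; rewrite mem_compositions => /andP [_ /eqP].
move=> sn; have nz : comp_of_set n S != [::] by case: comp_of_set sn => //=; lia.
have := rcons_setc nz; rewrite sn comp_of_setE // scanl_pairmap_subn.
  by move=> /rcons_inj [].
by move: vS; rewrite valid_set_path //; apply: sub_path => i j /ltnW.
Qed.

Lemma valid_set_eq n S T : valid_set n S -> valid_set n T -> S =i T -> S = T.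
Proof.
move=> /andP [sS _] /andP [sT _] ST.
by apply: (irr_sorted_eq ltn_trans ltnn).
Qed.

Lemma sum_setc_eq (R : numFieldType) n S (F : seq nat -> R) :
  valid_set n S ->
  \sum_(g <- compositions n) F g * (S == setc g)%:R = F (comp_of_set n S).
Proof.
move=> vS; rewrite (bigD1_seq (comp_of_set n S)) ?comp_of_set_mem //;
  last exact: uniq_compositions.
rewrite /= comp_of_setK // eqxx mulr1 big_seq_cond big1 ?addr0 // => g.
rewrite mem_compositions => /andP [/andP [pg /eqP <-] gS].
case: eqP => [SE|]; last by rewrite mulr0.
by move: gS; rewrite SE setcK // eqxx.
Qed.

(** A word of length [n] with positive letters occurs in exactly one ribbon series of degree [n],
    the one given by its descent set. *)
Lemma sum_rib (R : numFieldType) n (F : seq nat -> R) w :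
  \sum_(g <- compositions n) F g * rib R g w =
  ((size w == n) && pos w)%:R * F (comp_of_set n (desc w)).
Proof.
case: eqP => [<-|/eqP sw]; last first.
  rewrite mul0r big_seq big1 // => g.
  rewrite mem_compositions => /andP [_ /eqP sg].
  by rewrite /rib sg (negbTE sw) mulr0.
rewrite -(sum_setc_eq _ (valid_desc w)) big_distrr /= big_seq [RHS]big_seq.
apply: eq_bigr => g; rewrite mem_compositions => /andP [_ /eqP sg].
by rewrite /rib sg eqxx /= -mulnb natrM -/(desc w) mulrCA.
Qed.

(** * The linear coefficient of [H^t] and the exponential formula *)

Section Phi.
Variable R : numFieldType.

Lemma phinE n w :
  phin R n w = ((size w == n) && pos w)%:R *
    ((-1) ^+ size (desc w) / ('C(n.-1, size (desc w)))%:R).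
Proof.
rewrite /phin sum_rib; case: eqP => [<-|_]; last by rewrite !mul0r.
by rewrite -size_setc comp_of_setK ?valid_desc.
Qed.

Lemma prod_nat_sub_neg d : \prod_(i < d) (i%:R - d%:R) = (-1) ^+ d * d`!%:R :> R.
Proof.
elim: d => [|d IH]; first by rewrite big_ord0 mul1r.
rewrite big_ord_recl factS natrM exprS.
rewrite (eq_bigr (fun i : 'I_d => i%:R - d%:R)) ?IH.
  by rewrite -natr1 /=; ring.
by move=> i _; rewrite lift0 -!natr1; ring.
Qed.

(** The indices below [d] contribute [(-1)^d d!], those above [d] contribute [(n - 1 - d)!]. *)
Lemma prod_nat_sub_neq n d : (d < n)%N ->
  \prod_(i < n | i != d :> nat) (i%:R - d%:R) =
  (-1) ^+ d * d`!%:R * (n.-1 - d)`!%:R :> R.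
Proof.
elim: n => // n IH; rewrite ltnS leq_eqVlt => /orP [/eqP ->|dn].
  rewrite big_mkcond big_ord_recr /= eqxx subnn !mulr1 -prod_nat_sub_neg.
  by apply: eq_bigr => i _; rewrite neq_ltn ltn_ord.
rewrite big_mkcond big_ord_recr -big_mkcond IH //= neq_ltn dn orbT -natrB; last first.
  exact: ltnW.
have -> : (n - d = (n.-1 - d).+1)%N by lia.
by rewrite factS natrM; ring.
Qed.

(** Among the factors [X + i - d] the one with [i = d] is [X] itself, so the linear coefficient is
    the product of the other factors at [0], divided by [n!]. *)
Lemma coef1_hpow w : (hpow R w)`_1 = phin R (size w) w / (size w)%:R.
Proof.
case: (altP (w =P [::])) => [->|wn0].
  (* For the empty word the right-hand side is a division by [0], hence [0], which is the linear
     coefficient of the constant [1]. *)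
  by rewrite invr0 mulr0 /hpow big_ord0 coefZ coef1 mulr0.
have := size_desc_lt wn0; rewrite phinE eqxx /= /hpow coefZ.
move: (size (desc w)) => d dw.
rewrite (bigD1 (Ordinal dw)) //= subrr addr0 coefXM /= -horner_coef0 horner_prod.
rewrite (eq_bigr (fun i : 'I_(size w) => i%:R - d%:R)); last first.
  by move=> i _; rewrite hornerD hornerX hornerC add0r.
rewrite (eq_bigl (fun i : 'I_(size w) => i != d :> nat)) // prod_nat_sub_neq //.
have n0 : (size w)%:R != 0 :> R by rewrite pnatr_eq0 size_eq0.
have bin0 : ('C((size w).-1, d))%:R != 0 :> R by rewrite pnatr_eq0 -lt0n bin_gt0; lia.
have -> : (size w)`! = (size w * ('C((size w).-1, d) * (d`! * ((size w).-1 - d)`!)))%N.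
  by rewrite bin_fact; [case: (size w) dw | lia].
rewrite !natrM; have f1 := factR_neq0 R d; have f2 := factR_neq0 R ((size w).-1 - d).
by field; rewrite n0 bin0 f1 f2.
Qed.

Lemma phiA_cons k b w :
  phiA R (k :: b) w =
  (k <= size w)%N%:R * (phin R k (take k w) * phiA R b (drop k w)).
Proof. by apply: ncmul_homog => v; apply: phin_homog. Qed.

#[local] Arguments phiA : simpl never.

Definition prodn (b : seq nat) : nat := (\prod_(i <- b) i)%N.

(** The exponential formula, one coefficient at a time: [coef_hpowS] peels off a prefix, whose
    length [k] becomes the first part of [b] and which contributes [phi_k / k]. *)
Lemma coef_hpow w j :
  j`!%:R * (hpow R w)`_j =
  \sum_(b <- compositions (size w) | size b == j) phiA R b w / (prodn b)%:R.
Proof.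
elim: j w => [|j IH] w.
  rewrite mul1r -horner_coef0 hpow0; case: w => [|x w].
    by rewrite /compositions /= big_mkcond big_seq1 /= /prodn big_nil divr1.
  rewrite big_compositionsS big1 // => k _; by rewrite big_pred0.
case: w => [|x w].
  rewrite /compositions /= big_mkcond big_seq1 /= /hpow big_ord0 coefZ coef1.
  by rewrite !mulr0.
rewrite factS natrM -mulrA mulrCA [j.+1%:R * _]mulr_natl.
rewrite coef_hpowS /ncmul big_ord_recl coef1_hpow.
(* The empty prefix contributes [0], so the remaining cuts run over the possible first parts. *)
rewrite take0 invr0 mulr0 mul0r add0r big_distrr /= big_compositionsS.
apply: eq_bigr => k _; rewrite mulrCA.
have -> : (size w - k = size (drop k w))%N by rewrite size_drop.
rewrite IH big_distrr /=; apply: eq_bigr => b _.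
rewrite coef1_hpow phiA_cons /= size_takel; last by have := ltn_ord k; lia.
rewrite ltnS; have -> : (k <= size w)%N by have := ltn_ord k; lia.
by rewrite mul1r /prodn big_cons natrM invfM; ring.
Qed.

Lemma hpow_phi w t :
  (hpow R w).[t] =
  \sum_(b <- compositions (size w))
     t ^+ size b / (size b)`!%:R * (phiA R b w / (prodn b)%:R).
Proof.
rewrite (horner_coef_wide _ (hpow_size R w)).
rewrite [RHS]big_seq.
(* A composition has at most as many parts as its sum, so [inord] does not alter the number of
   parts. *)
rewrite (partition_big (fun b => inord (size b) : 'I_(size w).+1) predT) //=.
apply: eq_bigr => j _.
have -> : (hpow R w)`_j = j`!%:R^-1 *
    \sum_(b <- compositions (size w) | size b == j) phiA R b w / (prodn b)%:R.
  by rewrite -coef_hpow mulKf ?factR_neq0.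
rewrite mulrAC big_distrr big_seq_cond /=.
apply: eq_big => [b|b /andP [_ /eqP ->]]; last by ring.
apply: andb_id2l; rewrite mem_compositions => /andP [pb /eqP sb].
by rewrite -val_eqE /= inordK // ltnS -sb size_le_sumn.
Qed.

End Phi.

(** * Counting the indexings of a wall *)

Section ColourStabiliser.
Variables (T : finType) (f : T -> nat).

(** The colours whose points may move are a parameter, so that the stabiliser can be counted one
    colour at a time. *)
Let stab (vs : seq nat) : {set {perm T}} :=
  [set s : {perm T} | [forall x, (f (s x) == f x) && ((f x \in vs) || (s x == x))]].

Let stabP vs (s : {perm T}) :
  reflect (forall x, f (s x) = f x /\ (f x \notin vs -> s x = x)) (s \in stab vs).
Proof.
rewrite inE; apply: (iffP forallP) => H x.
  by have /andP [/eqP -> /orP [->|/eqP]] := H x.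
have [-> sx] := H x; rewrite eqxx /=; case: (boolP (f x \in vs)) => //= /sx ->.
by rewrite eqxx.
Qed.

(** A colour-preserving permutation is its restriction to the class of [v] times its restriction to
    the other classes. *)
Let stab_cons v vs : v \notin vs ->
  stab (v :: vs) =
  [set (p.1 * p.2)%g | p in setX [set s | perm_on [set x | f x == v] s] (stab vs)].
Proof.
move=> vvs; apply/setP => s; apply/stabP/imsetP; last first.
  case=> -[p q] /setXP [/=]; rewrite inE => pS /stabP qS -> x; rewrite permM.
  have fp : f (p x) = f x.
    case: (boolP (x \in [set x | f x == v])) => xS; last by rewrite (out_perm pS).
    by have := perm_closed x pS; rewrite xS; move: xS; rewrite !inE => /eqP -> /eqP.
  have [-> qfix] := qS (p x); split=> //; rewrite inE negb_or => /andP [xv xvs].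
  by rewrite qfix ?fp // (out_perm pS) // inE.
move=> sS; have fs x : f (s x) = f x by have [] := sS x.
have pinj : injective (fun x => if f x == v then s x else x).
  move=> x y; case: ifP => /eqP fx; case: ifP => /eqP fy E //; first exact: perm_inj E.
    by rewrite -E fs in fy.
  by rewrite E fs in fx.
have qinj : injective (fun x => if f x == v then x else s x).
  move=> x y; case: ifP => /eqP fx; case: ifP => /eqP fy E //; last exact: perm_inj E.
    by rewrite E fs in fx.
  by rewrite -E fs in fy.
exists (perm pinj, perm qinj); last first.
  apply/permP => x; rewrite permM !permE.
  by case: (boolP (f x == v)) => fx; rewrite ?fs ?(negbTE fx) ?fx.
apply/setXP; split=> /=.
  rewrite inE; apply/subsetP => x; rewrite !inE permE; case: ifP => //.
  by rewrite eqxx.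
apply/stabP => x; rewrite permE; case: ifP => // fx; split=> // xvs.
by have [_ ->] := sS x; rewrite // inE fx.
Qed.

Let card_stab vs : uniq vs ->
  #|stab vs| = (\prod_(v <- vs) #|[set x | f x == v]|`!)%N.
Proof.
elim: vs => [_|v vs IH /= /andP [vvs /IH {}IH]].
  rewrite big_nil (_ : stab [::] = [set 1%g]) ?cards1 //.
  apply/setP => s; rewrite in_set1; apply/stabP/eqP => [sS|-> x]; last by rewrite perm1.
  by apply/permP => x; rewrite perm1; have [_ ->] := sS x.
rewrite stab_cons // card_in_imset; last first.
  move=> [p q] [p' q'] /setXP [/= pS qS] /setXP [/= p'S q'S] E.
  rewrite !inE in pS p'S.
  (* The factorisation is unique: the second factor fixes the class of [v], so the first can be read
     off there, and it is the identity elsewhere. *)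
  suff pp' : p = p' by congr pair => //; move: E; rewrite /= pp' => /mulgI.
  apply/permP => x; case: (boolP (x \in [set x | f x == v])) => xS; last first.
    by rewrite !(out_perm _ xS).
  have /stabP /(_ (p x)) [_ qx] := qS; have /stabP /(_ (p' x)) [_ qx'] := q'S.
  have := perm_closed x pS; have := perm_closed x p'S.
  rewrite xS !inE => /eqP fx' /eqP fx.
  move/permP/(_ x): E; rewrite !permM qx ?fx // qx' ?fx' //.
rewrite cardsX IH big_cons -card_perm; congr muln.
by apply: eq_card => s; rewrite inE.
Qed.

Lemma card_colour_stab (vs : seq nat) : uniq vs -> (forall x, f x \in vs) ->
  #|[set s : {perm T} | [forall x, f (s x) == f x]]| =
  (\prod_(v <- vs) #|[set x | f x == v]|`!)%N.
Proof.
move=> uvs fvs; rewrite -card_stab //; apply: eq_card => s; rewrite !inE.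
by apply: eq_forallb => x; rewrite fvs andbT.
Qed.

End ColourStabiliser.

(** The number of indexings of a wall of type [b], by [card_lab_ok]: only bricks of equal size can
    exchange labels. *)
Definition labn (b : seq nat) : nat := (\prod_(i <- undup b) (count_mem i b)`!)%N.

Lemma zcE b : zc b = (prodn b * labn b)%N.
Proof.
rewrite /zc big_split /=; congr muln.
exact: (big_undup_iterop_count muln b predT id).
Qed.

(* A labelling is admissible iff reading the bricks by label sorts them; fixing
   one such labelling turns the admissible ones into the stabiliser of the
   colouring of the bricks by size. *)
Lemma card_lab_ok b : #|[pred s : {perm 'I_(size b)} | lab_ok s]| = labn b.
Proof.
pose n := size b; pose f (i : 'I_n) := nth 0%N b i.
have [p Hp] : exists p : {perm 'I_n},
    sort leq b = [tuple tnth (in_tuple b) (p i) | i < n].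
  by apply/tuple_permP; rewrite perm_sort.
have fp (i : 'I_n) : nth 0%N (sort leq b) i = f (p i).
  by rewrite Hp nth_mktuple (tnth_nth 0%N).
(* [p] sorts the bricks and [s * p] applies [s] first, so invariance says that brick [x] has the
   size found at rank [s x] of the sorted list. *)
have lab_okE (s : {perm 'I_n}) : lab_ok s = [forall x, f ((s * p)%g x) == f x].
  apply/forallP/forallP => [H x|H j].
    have nt (i : 'I_n) : nth 0%N [tuple f (s^-1%g i) | i < n] i = f (s^-1%g i).
      exact: nth_mktuple.
    (* Consecutive labels suffice: a drop in size from label [i] to [i + 1] would force
       [i + 1 < i]. *)
    have srt : sorted leq [tuple f (s^-1%g i) | i < n].
      apply: (path_sorted (x := 0%N)); apply/(pathP 0%N) => i.
      rewrite size_tuple => i_n; case: i i_n => [//|i] i_n.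
      have i_n' : (i < n)%N by lia.
      have := nt (Ordinal i_n); have := nt (Ordinal i_n') => /= -> ->.
      rewrite leqNgt; apply/negP => lt.
      have /forallP /(_ (s^-1%g (Ordinal i_n'))) /implyP := H (s^-1%g (Ordinal i_n)).
      by move/(_ lt); rewrite !permKV /= ltnNge leqnSn.
    have E : [tuple f (s^-1%g i) | i < n] = sort leq b :> seq nat.
      apply: (sorted_eq leq_trans anti_leq srt (sort_sorted leq_total b)).
      rewrite perm_sym perm_sort perm_sym.
      apply/(@tuple_permP _ n _ (in_tuple b)); exists (s^-1)%g.
      by congr val; apply: eq_mktuple => i; rewrite (tnth_nth 0%N).
    rewrite permM -fp -E nt permK; exact: eqxx.
  apply/forallP => k; apply/implyP.
  have /eqP := H j; have /eqP := H k; rewrite !permM -!fp /f => <- <-.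
  apply: contraTT; rewrite -!leqNgt => sks.
  apply: (sorted_leq_nth leq_trans leqnn 0%N (sort_sorted leq_total b)) => //;
    by rewrite inE size_sort.
transitivity #|[set s : {perm 'I_n} | [forall x, f (s x) == f x]]|.
  rewrite -(card_preimset _ (@mulIg _ p)); apply: eq_card => s.
  by rewrite !inE lab_okE.
rewrite (@card_colour_stab _ _ (undup b)) ?undup_uniq //; last first.
  by move=> x; rewrite mem_undup mem_nth.
apply: eq_bigr => v _; congr (_`!); rewrite -sum1_card -sum1_count.
rewrite (big_nth 0%N) big_mkord; apply: eq_bigl => i; by rewrite inE.
Qed.

Lemma sum_lab_ok (R : numFieldType) b (x : R) :
  \sum_(s : {perm 'I_(size b)} | lab_ok s) x = (labn b)%:R * x.
Proof. by rewrite sumr_const card_lab_ok mulr_natl. Qed.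

(** * The wall expansions of h and e *)

Lemma mem_walls a B : (B \in walls a) = (wshape B == a) && all pos B.
Proof.
elim: a B => [|k a IH] [|b B] //=.
  by apply/negbTE/allpairsP => -[[c rest] /= []].
rewrite eqseq_cons; apply/allpairsP/idP => [[[c rest] /= [ck rB [-> ->]]]|].
  by move: ck rB; rewrite mem_compositions IH => /andP [-> ->] /andP [-> ->].
move=> /andP [/andP [sb sB] /andP [pb pB]].
by exists (b, B); rewrite mem_compositions IH pb sb sB pB.
Qed.

Lemma size_le_walls a B : B \in walls a -> (size (wtype B) <= sumn (wshape B))%N.
Proof.
rewrite mem_walls => /andP [_ pB]; rewrite /wshape -sumn_flatten.
by apply: size_le_sumn; elim: B pB => //= b B IH /andP [pb /IH]; rewrite pos_cat pb.
Qed.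

Section HE.
Variable R : numFieldType.
#[local] Arguments phiA : simpl never.

Lemma phiA_homog b w : size w != sumn b -> phiA R b w = 0.
Proof. by apply: ncprod_homog => k v; apply: phin_homog. Qed.

(** Unlike truncated differences, sums of exponents split over the rows of a wall. *)
Lemma signrB m n : (n <= m)%N -> (-1) ^+ (m - n) = (-1) ^+ (m + n) :> R.
Proof.
by move=> nm; rewrite -signr_odd -[RHS]signr_odd oddB // oddD.
Qed.

Lemma ncmulr1 (f : ncs R) w : ncmul f (ncone R) w = f w.
Proof.
rewrite /ncmul big_ord_recr /= take_size drop_size /ncone eqxx mulr1.
rewrite big1 ?add0r // => k _; rewrite -size_eq0 size_drop subn_eq0 leqNgt.
by rewrite ltn_ord mulr0.
Qed.

Lemma hpow1 w : (hpow R w).[1] = (pos w && sorted leq w)%:R.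
Proof.
rewrite -[X in _.[X]]add0r -ncmul_incr_hpow -/(incr R w) -[RHS](ncmulr1 (incr R)).
by apply: eq_ncmul => // v; rewrite hpow0.
Qed.

(** At [t = -1] the factors are [i - d - 1]. The one with [i = d + 1] vanishes whenever it occurs,
    so only strictly decreasing words survive. *)
Lemma hpowN1 w :
  (hpow R w).[-1] =
  (-1) ^+ size w * (pos w && sorted (fun x y => y < x)%N w)%:R.
Proof.
rewrite hpowE sorted_gt_desc; case: (altP (w =P [::])) => [->|wn0].
  by rewrite /rising big_ord0 /= divr1 !mulr1.
have := size_desc_lt wn0; move: (size (desc w)) => d dw.
rewrite -mulnb natrM; case: eqP => dE; last first.
  have dw' : (d.+1 < size w)%N by move: dw dE; case: (size w) => //= n; lia.
  rewrite /rising (bigD1 (Ordinal dw')) //= -natr1.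
  have -> : -1 - d%:R + (d%:R + 1) = 0 :> R by ring.
  by rewrite mul0r !mulr0.
have nE : (size w)%:R = d%:R + 1 :> R.
  by move: dw dE; case: (size w) => //= n _ ->; rewrite natr1.
have -> : rising (size w) (-1 - d%:R) = \prod_(i < size w) (i%:R - (size w)%:R) :> R.
  by apply: eq_bigr => i _; rewrite nE; ring.
by rewrite prod_nat_sub_neg /=; have := factR_neq0 R (size w) => f0; field.
Qed.

Lemma hn_phi k w :
  hn R k w = \sum_(b <- compositions k)
    ((size b)`!%:R^-1 / (prodn b)%:R) * phiA R b w.
Proof.
rewrite /hn; case: eqP => [<-|/eqP sw].
  rewrite -hpow1 hpow_phi; apply: eq_bigr => b _.
  by rewrite expr1n mul1r mulrA mulrAC.
rewrite big_seq big1 // => b; rewrite mem_compositions => /andP [_ /eqP sb].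
by rewrite phiA_homog ?mulr0 // sb.
Qed.

Lemma en_phi k w :
  en R k w = \sum_(b <- compositions k)
    ((-1) ^+ (sumn b + size b) * ((size b)`!%:R^-1 / (prodn b)%:R)) * phiA R b w.
Proof.
rewrite /en; case: eqP => [<-|/eqP sw].
  transitivity ((-1) ^+ size w * (hpow R w).[-1]).
    by rewrite hpowN1 mulrA -expr2 sqrr_sign mul1r.
  rewrite hpow_phi big_distrr big_seq [RHS]big_seq; apply: eq_bigr => b /=.
  rewrite mem_compositions => /andP [_ /eqP ->].
  by rewrite exprD; ring.
rewrite big_seq big1 // => b; rewrite mem_compositions => /andP [_ /eqP sb].
by rewrite phiA_homog ?mulr0 // sb.
Qed.

(** Expanding the product chooses one composition per row, that is a wall; by [ncprod_cat] the
    product of the rows is [phiA] of the type. *)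
Lemma ncprod_walls (F : nat -> ncs R) (c : seq nat -> R) :
  (forall k w, F k w = \sum_(b <- compositions k) c b * phiA R b w) ->
  forall a w, ncprod F a w =
    \sum_(B <- walls a) (\prod_(b <- B) c b) * phiA R (wtype B) w.
Proof.
move=> FE; elim=> [|k a IH] w /=; first by rewrite big_seq1 big_nil mul1r.
rewrite big_allpairs_dep (eq_ncmul _ (FE k) IH) /ncmul /=.
under eq_bigr do rewrite big_distrlr /=.
rewrite exchange_big /=; apply: eq_bigr => b _.
rewrite exchange_big /=; apply: eq_bigr => B _.
rewrite big_cons /phiA ncprod_cat /ncmul big_distrr /=.
by apply: eq_bigr => i _; ring.
Qed.

Lemma prod_row_weights B :
  \prod_(b <- B) ((size b)`!%:R^-1 / (prodn b)%:R) =
  (fb B)%:R^-1 / (prodn (wtype B))%:R :> R.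
Proof.
rewrite big_split /= !prodfV -!natr_prod; congr (_ / _%:R).
by rewrite /prodn /wtype big_flatten.
Qed.

Lemma labn_neq0 b : (labn b)%:R != 0 :> R.
Proof.
by rewrite pnatr_eq0 -lt0n; apply: prodn_gt0 => i; apply: fact_gt0.
Qed.

Lemma IWsum_shapeE a (F : seq (seq nat) -> R) :
  IWsum_shape a F = \sum_(B <- walls a) (labn (wtype B))%:R * F B.
Proof. by apply: eq_bigr => B _; rewrite sum_lab_ok. Qed.

(** Each wall occurs once per indexing, which turns its [1 / z] into the inverse of the product of
    its parts. *)
Lemma labn_div_zc b (x : R) : (labn b)%:R * (x / (zc b)%:R) = x / (prodn b)%:R.
Proof.
rewrite zcE natrM invfM; have l0 := labn_neq0 b.
by rewrite mulrCA [_ / (labn b)%:R]mulrC [_ * (_^-1 * _)]mulrA divff // mul1r.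
Qed.

Lemma hA_walls a w :
  hA R a w = \sum_(B <- walls a)
    (fb B)%:R^-1 * (phiA R (wtype B) w / (prodn (wtype B))%:R).
Proof.
rewrite /hA (ncprod_walls hn_phi); apply: eq_bigr => B _.
by rewrite prod_row_weights -mulrA [_^-1 * phiA _ _ _]mulrC.
Qed.

Lemma eA_walls a w :
  eA R a w = \sum_(B <- walls a)
    (-1) ^+ (sumn (wshape B) - size (wtype B)) / (fb B)%:R *
      (phiA R (wtype B) w / (prodn (wtype B))%:R).
Proof.
rewrite /eA (ncprod_walls en_phi) big_seq [RHS]big_seq; apply: eq_bigr => B Ba.
rewrite big_split /= prod_row_weights signrB ?(size_le_walls Ba) //.
rewrite prodrXr big_split /= (_ : (_ + _ = sumn (wshape B) + size (wtype B))%N).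
  by ring.
by rewrite size_flatten /shape !sumnE !big_map.
Qed.

Lemma hA_indexed_walls a w :
  hA R a w = IWsum_shape a (fun B =>
    (fb B)%:R^-1 * (phiA R (wtype B) w / (zc (wtype B))%:R)).
Proof.
rewrite hA_walls IWsum_shapeE; apply: eq_bigr => B _.
by rewrite [RHS]mulrCA labn_div_zc.
Qed.

Lemma eA_indexed_walls a w :
  eA R a w = IWsum_shape a (fun B =>
    (-1) ^+ (sumn (wshape B) - size (wtype B)) / (fb B)%:R *
      (phiA R (wtype B) w / (zc (wtype B))%:R)).
Proof.
rewrite eA_walls IWsum_shapeE; apply: eq_bigr => B _.
by rewrite [RHS]mulrCA labn_div_zc.
Qed.

End HE.

(** * Monomial quasisymmetric functions and complements *)

Definition asc (w : seq nat) : seq nat :=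
  [seq j <- iota 1 (size w).-1 | nth 0 w j.-1 < nth 0 w j]%N.

Lemma mem_asc w j :
  (j \in asc w) = (0 < j < size w)%N && (nth 0 w j.-1 < nth 0 w j)%N.
Proof. by rewrite mem_filter mem_iota andbC; congr andb; lia. Qed.

Lemma valid_asc w : valid_set (size w) (asc w).
Proof.
rewrite /valid_set (sorted_filter ltn_trans) ?iota_ltn_sorted //.
by apply/allP => j; rewrite mem_asc => /andP [].
Qed.

Lemma asc_cons x y u :
  asc (x :: y :: u) =
  (if x < y then [:: 1] else [::])%N ++ [seq j.+1 | j <- asc (y :: u)].
Proof.
rewrite /asc /= -[in iota 2 _](addn1 1%N) iotaDl filter_map.
rewrite (eq_in_filter (a2 := fun j => nth 0 (y :: u) j.-1 < nth 0 (y :: u) j)%N).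
  by case: ifP.
by move=> i; rewrite mem_iota /=; case: i.
Qed.

Lemma asc_nseq_cat k x y v : (x < y)%N ->
  asc (nseq k.+1 x ++ y :: v) =
  k.+1 :: [seq (k.+1 + j)%N | j <- asc (y :: v)].
Proof.
move=> xy; elim: k => [|k IH]; first by rewrite asc_cons xy.
by move: IH; rewrite /= asc_cons ltnn => -> /=; rewrite -map_comp.
Qed.

Lemma asc_nseq k x : asc (nseq k x) = [::].
Proof.
elim: k => // -[|k] IH //.
by move: IH; rewrite [nseq k.+2 x]/= asc_cons ltnn => ->.
Qed.

Lemma setc_cons k g :
  setc (k :: g) =
  if g is [::] then [::] else k :: [seq (k + j)%N | j <- setc g].
Proof.
case: g => // x g; rewrite /setc /= addn0; congr cons.
rewrite -[in iota 2 _](addn1 1%N) iotaDl -!map_comp.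
by apply: eq_map => i.
Qed.

(** The word of the monomial with exponents [g] in the variables [l], as it occurs in [Mmon]. *)
Definition expand (g l : seq nat) : seq nat :=
  flatten [seq nseq p.1 p.2 | p <- zip g l].

Lemma size_expand g l : size l = size g -> size (expand g l) = sumn g.
Proof.
elim: g l => [|k g IH] [|x l] //= [sl].
by rewrite /expand /= size_cat size_nseq IH.
Qed.

Lemma pos_expand g l : pos l -> pos (expand g l).
Proof.
elim: g l => [|k g IH] [|x l] //= /andP [x0 pl].
by rewrite /expand /= pos_cat [pos (flatten _)]IH // /pos all_nseq x0 orbT.
Qed.

(** Parts are positive, so no block is empty; [l] strictly increases, so the ascents are exactly the
    block boundaries. *)
Lemma asc_expand g l : pos g -> sorted ltn l -> size l = size g ->
  asc (expand g l) = setc g.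
Proof.
elim: g l => [|k g IH] [|x l] // /andP [k0 pg] sl [sz].
have {IH} := IH l pg (path_sorted sl) sz.
case: k k0 => // k _; rewrite setc_cons /expand /=.
case: g pg sz => [|k' g]; case: l sl => [|x' l] //.
  by move=> _ _ _ _; rewrite cats0 (asc_nseq k.+1).
move=> /andP [xx' _] /andP [k0 _] _; case: k' k0 => // k' _ /= IH.
by rewrite (asc_nseq_cat k _ xx') IH.
Qed.

Lemma expand_sorted g l : sorted ltn l -> sorted leq (expand g l).
Proof.
rewrite !sorted_pairwise; [|exact: leq_trans|exact: ltn_trans].
elim: g l => [|k g IH] [|x l] //= /andP [xl sl].
rewrite /expand /= pairwise_cat [pairwise leq (flatten _)]IH // andbT.
have nsq : pairwise leq (nseq k x).
  by elim: k => //= k ->; rewrite andbT all_nseq leqnn orbT.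
rewrite nsq andbT; apply/allrelP => y z.
rewrite mem_nseq => /andP [_ /eqP ->] /flattenP [_ /mapP [p pz ->]].
rewrite mem_nseq => /andP [_ /eqP ->].
apply/ltnW/(allP xl); have : p.2 \in unzip2 (zip g l) by apply: map_f.
elim: g (l) {IH pz xl sl nsq} => [|? ? IHg] [|? ?] //=.
by rewrite !inE => /orP [->|/IHg ->]; rewrite ?orbT.
Qed.

Lemma expand_inj g l l' : pos g -> size l = size g -> size l' = size g ->
  expand g l = expand g l' -> l = l'.
Proof.
elim: g l l' => [|k g IH] [|x l] [|x' l'] // /andP [k0 pg] [sl] [sl'].
move/eqP; rewrite /expand /= eqseq_cat ?size_nseq // => /andP [/eqP E /eqP E'].
rewrite (IH l l') //; congr cons.
by case: k k0 E => // k _ [].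
Qed.

Lemma expand_undup w : sorted leq w ->
  expand [seq count_mem x w | x <- undup w] (undup w) = w.
Proof.
move=> sw; apply: (sorted_eq leq_trans anti_leq) => //.
  apply: expand_sorted; rewrite ltn_sorted_uniq_leq undup_uniq.
  exact: (undup_sorted leq_trans).
rewrite /expand; apply: perm_trans (perm_count_undup w).
by rewrite -[X in zip _ X]map_id zip_map -map_comp.
Qed.

(** A weakly increasing word determines its distinct letters and their multiplicities, so the only
    tuple that [Mmon] can count is [undup w]. *)
Lemma MmonE (R : numFieldType) g w : pos g ->
  Mmon R g w =
  ((size w == sumn g) && pos w && sorted leq w && (asc w == setc g))%:R.
Proof.
move=> pg; rewrite /Mmon; congr (_%:R).
case: (boolP (_ && _)) => [|ncond]; last first.
  apply: eq_card0 => j; apply/negbTE; apply: contra ncond; rewrite inE.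
  move=> /andP [/andP [sj pj] /eqP <-].
  have szj : size (map val j) = size g by rewrite size_map size_tuple.
  by rewrite size_expand // pos_expand // expand_sorted // asc_expand // !eqxx.
case/andP => /andP [/andP [/eqP sw pw] srt] /eqP aw.
pose l := undup w.
have pl : pos l by apply/allP => x; rewrite mem_undup => /(allP pw).
have sl : sorted ltn l.
  rewrite ltn_sorted_uniq_leq undup_uniq.
  exact: (undup_sorted leq_trans).
(* The multiplicities in [w] have the same partial sums and total as [g], and these determine a
   composition. *)
have gE : [seq count_mem x w | x <- l] = g.
  set g' := map _ _; have pg' : pos g'.
    apply/allP => _ /mapP [x xl ->]; rewrite -has_count has_pred1.
    by rewrite -mem_undup.
  have szl : size l = size g' by rewrite size_map.
  have aw' : asc w = setc g' by rewrite -(asc_expand pg' sl szl) expand_undup.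
  have sw' : sumn g' = size w by rewrite -(size_expand szl) expand_undup.
  by rewrite -(setcK pg') -(setcK pg) -aw -sw aw' sw'.
have wE : expand g l = w by rewrite -gE expand_undup.
have szl : size l = size g by rewrite -gE size_map.
(* The bound in [Mmon]; every letter is at most [m], so [inord] preserves it. *)
pose m := (\max_(i <- w) i)%N.
have szt : size (map (@inord m) l) == size g by rewrite size_map szl.
have vt : map val (Tuple szt) = l.
  rewrite /= -map_comp map_id_in // => x; rewrite mem_undup => xw /=.
  by rewrite inordK // ltnS; apply: (@leq_bigmax_seq _ w predT id).
apply: (eq_card1 (x := Tuple szt)) => j; rewrite !inE.
apply/idP/eqP => [/andP [_ /eqP jw]|->]; last first.
  by rewrite vt sl pl -/(expand g l) wE eqxx.
apply/val_inj/(inj_map val_inj); rewrite -[map val (val _)]/(map val j) vt.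
apply: (expand_inj pg) => //; first by rewrite size_map size_tuple.
by rewrite wE.
Qed.

(** * Words with a prescribed descent or ascent set *)

Definition dword (n : nat) (S : seq nat) : seq nat :=
  [seq (count (fun s => j < s) S).+1 | j <- iota 0 n]%N.
Definition aword (n : nat) (S : seq nat) : seq nat :=
  [seq (count (fun s => s <= j) S).+1 | j <- iota 0 n]%N.

Lemma size_dword n S : size (dword n S) = n.
Proof. by rewrite size_map size_iota. Qed.

Lemma pos_dword n S : pos (dword n S).
Proof. by apply/allP => _ /mapP [j _ ->]. Qed.

Lemma nth_dword n S j : (j < n)%N ->
  nth 0%N (dword n S) j = (count (fun s => j < s) S).+1%N.
Proof. by move=> jn; rewrite (nth_map 0%N) ?size_iota // nth_iota. Qed.

(** From position [j - 1] to [j] the count loses exactly the occurrences of [j] in [S]. *)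
Lemma dword_descP n S j : (0 < j < n)%N ->
  (nth 0 (dword n S) j < nth 0 (dword n S) j.-1)%N = (j \in S).
Proof.
move=> /andP [j0 jn]; rewrite !nth_dword //; last by lia.
have -> : (count (fun s => j.-1 < s) S = count (fun s => j < s) S + count_mem j S)%N.
  by elim: S => //= s S ->; lia.
by rewrite -has_pred1 has_count; lia.
Qed.

Lemma desc_dword n S : valid_set n S -> desc (dword n S) = S.
Proof.
move=> vS; have vD := valid_desc (dword n S); rewrite size_dword in vD.
apply: (valid_set_eq vD vS) => j; rewrite mem_desc size_dword.
case: (boolP (0 < j < n)%N) => jn; first by rewrite dword_descP.
apply/esym/negbTE; apply: contra jn => jS.
by case/andP: vS => _ /allP /(_ _ jS).
Qed.

Lemma size_aword n S : size (aword n S) = n.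
Proof. by rewrite size_map size_iota. Qed.

Lemma pos_aword n S : pos (aword n S).
Proof. by apply/allP => _ /mapP [j _ ->]. Qed.

Lemma nth_aword n S j : (j < n)%N ->
  nth 0%N (aword n S) j = (count (fun s => s <= j) S).+1%N.
Proof. by move=> jn; rewrite (nth_map 0%N) ?size_iota // nth_iota. Qed.

Lemma sorted_aword n S : sorted leq (aword n S).
Proof.
apply: (homo_sorted (e := leq)); last exact: iota_sorted.
by move=> i j ij; rewrite ltnS; apply: sub_count => s /= /leq_trans ->.
Qed.

Lemma aword_ascP n S j : (0 < j < n)%N ->
  (nth 0 (aword n S) j.-1 < nth 0 (aword n S) j)%N = (j \in S).
Proof.
move=> /andP [j0 jn]; rewrite !nth_aword //; last by lia.
have -> : (count (fun s => s <= j) S = count (fun s => s <= j.-1) S + count_mem j S)%N.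
  by elim: S => //= s S ->; lia.
by rewrite -has_pred1 has_count; lia.
Qed.

(** * Complementation of compositions *)

Lemma mem_compl g j : pos g ->
  (j \in setc (compl g)) = (0 < j < sumn g)%N && (j \notin setc g).
Proof.
move=> pg; rewrite comp_of_setK.
  by rewrite mem_filter mem_iota andbC; congr andb; lia.
rewrite /valid_set (sorted_filter ltn_trans) ?iota_ltn_sorted //.
by apply/allP => i; rewrite mem_filter mem_iota => /andP [_]; lia.
Qed.

Lemma compl_mem n g : g \in compositions n -> compl g \in compositions n.
Proof.
rewrite mem_compositions => /andP [pg /eqP <-]; apply: comp_of_set_mem.
rewrite /valid_set (sorted_filter ltn_trans) ?iota_ltn_sorted //.
by apply/allP => i; rewrite mem_filter mem_iota => /andP [_]; lia.
Qed.

Lemma setc_eq n g g' : g \in compositions n -> g' \in compositions n ->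
  setc g =i setc g' -> g = g'.
Proof.
rewrite !mem_compositions => /andP [pg /eqP sg] /andP [pg' /eqP sg'] E.
have := valid_setc pg; have := valid_setc pg'; rewrite sg sg' => v' v.
by rewrite -(setcK pg) -(setcK pg') sg sg' (valid_set_eq v v' E).
Qed.

Lemma complK n g : g \in compositions n -> compl (compl g) = g.
Proof.
move=> gn; have cn := compl_mem gn; have ccn := compl_mem cn.
apply: (setc_eq ccn gn) => j; move: gn cn; rewrite !mem_compositions.
move=> /andP [pg /eqP sg] /andP [pc /eqP sc]; rewrite !mem_compl // sc sg.
have /andP [_ /allP v] := valid_setc pg.
case: (boolP (j \in setc g)) => [/v|]; last by case: (0 < j < n)%N.
by rewrite sg => ->.
Qed.

Lemma big_compl (V : nmodType) n (F : seq nat -> V) :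
  \sum_(g <- compositions n) F (compl g) = \sum_(g <- compositions n) F g.
Proof.
rewrite -(big_map compl predT F); apply: perm_big; apply: uniq_perm.
- rewrite map_inj_in_uniq ?uniq_compositions // => g g' gn gn' /(congr1 compl).
  by rewrite (complK gn) (complK gn').
- exact: uniq_compositions.
move=> g; apply/mapP/idP => [[g' gn' ->]|gn]; first exact: compl_mem.
by exists (compl g); rewrite ?(complK gn) ?compl_mem.
Qed.

(** * Duality *)

Section Duality.
Variable R : numFieldType.
#[local] Arguments phiA : simpl never.
#[local] Arguments hA : simpl never.

Lemma sorted_take_desc k w :
  sorted leq (take k w) = all (fun j => (k <= j)%N) (desc w).
Proof.
rewrite sorted_leq_desc size_eq0; apply/eqP/allP => [dk j jw|dk].
  rewrite leqNgt; apply/negP => jk; move: jw; rewrite mem_desc => /andP [jw lt].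
  suff : j \in desc (take k w) by rewrite dk.
  by rewrite mem_desc !nth_take ?lt; try lia; rewrite size_take; case: ifP; lia.
case E: (desc (take k w)) => [//|j s].
have : j \in desc (take k w) by rewrite E mem_head.
rewrite mem_desc size_take => /andP [jw lt].
have jk : (j < k)%N by move: jw; case: ifP; lia.
have := dk j; rewrite mem_desc (leqNgt k j) jk; case: andP => [_ /(_ isT) //|[]]; split.
  by move: jw; case: ifP; lia.
by move: lt; rewrite !nth_take //; lia.
Qed.

(** A word is a concatenation of weakly increasing blocks of lengths [g] iff its descents lie on
    block boundaries; so [h_g] is the sum of the ribbons whose set is contained in that of [g]. *)
Lemma hAE g w : pos g ->
  hA R g w = ((size w == sumn g) && pos w && all (mem (setc g)) (desc w))%:R.
Proof.
elim: g w => [|k g IH] w.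
  by move=> _; case: w => // x w; rewrite /hA /ncprod /ncone.
move=> /andP [/= k0 pg].
have -> : hA R (k :: g) w =
    (k <= size w)%N%:R * (hn R k (take k w) * hA R g (drop k w)).
  by apply: ncmul_homog => v sv; rewrite /hn (negbTE sv).
rewrite IH // /hn size_drop.
case: (leqP k (size w)) => kw; last by rewrite mul0r; case: eqP => //; lia.
rewrite size_takel // eqxx mul1r /= -natrM mulnb; congr (nat_of_bool _)%:R.
have -> : (size w - k == sumn g)%N = (size w == k + sumn g)%N by lia.
case: eqP => [sw|]; last by rewrite !andbF.
rewrite (pos_take_drop k w) /=; case: (pos (take k w)) => //=.
case: (pos (drop k w)) => /=; last by rewrite andbF.
rewrite sorted_take_desc; apply/andP/allP => [[/allP h1 /allP h2] j jw|h].
  have := h1 j jw => kj; rewrite inE setc_cons.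
  move: jw; rewrite mem_desc => /andP [jw lt].
  case: g pg sw {IH h1} h2 => [|k' g] pg sw h2; first by rewrite /= in sw; lia.
  rewrite inE; case: eqP => //= jk.
  have -> : j = (k + (j - k))%N by lia.
  apply: map_f; apply: h2; rewrite mem_desc size_drop !nth_drop.
  have -> : (k + (j - k) = j)%N by lia.
  have -> : (k + (j - k).-1 = j.-1)%N by lia.
  by rewrite lt; lia.
split; apply/allP => j jw.
  have := h j jw; rewrite inE setc_cons; case: (g) => // k' g'.
  by rewrite inE => /orP [/eqP ->|/mapP [i _ ->]] //; lia.
have : (k + j)%N \in desc w.
  move: jw; rewrite !mem_desc size_drop !nth_drop.
  case: j => // j /=; rewrite addnS /= => /andP [jw ->]; lia.
move/h; rewrite !inE setc_cons; case: (g) => // k' g'.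
move: jw; rewrite mem_desc inE => /andP [jw _] /orP [/eqP|/mapP [i ig]]; first by lia.
by move/addnI => ->.
Qed.

Lemma phiA_not_pos b w : ~~ pos w -> phiA R b w = 0.
Proof.
elim: b w => [|k b IH] w pw; first by case: w pw.
rewrite phiA_cons phinE; move: pw; rewrite (pos_take_drop k w) negb_and.
by case/orP => [/negbTE ->|/IH ->]; rewrite ?andbF ?mul0r ?mulr0.
Qed.

Lemma sign_nat_exp (e : bool) n : (-1) ^+ (e * n) = if e then (-1) ^+ n else 1 :> R.
Proof. by case: e; rewrite ?mul1n. Qed.

(** [e = false] relates words with equal descents, [e = true] words with complementary ones. One
    induction then shows both that [phiA] depends only on the descents and how it changes sign. *)
Definition desc_twist (e : bool) (w w' : seq nat) : Prop :=
  size w' = size w /\ forall j, (0 < j < size w)%N ->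
    (nth 0 w' j < nth 0 w' j.-1)%N = e (+) (nth 0 w j < nth 0 w j.-1)%N.

Lemma size_desc_twist e w w' : desc_twist e w w' ->
  size (desc w') = if e then ((size w).-1 - size (desc w))%N else size (desc w).
Proof.
case=> sw tw; rewrite !size_filter sw.
rewrite (eq_in_count (a2 := fun j => e (+) (nth 0 w j < nth 0 w j.-1)%N)); last first.
  by move=> j; rewrite mem_iota => jw; apply: tw; lia.
case: e {tw} => //=; rewrite -[X in (X - _)%N](size_iota 1).
rewrite -(count_predC (fun j => nth 0 w j < nth 0 w j.-1)%N (iota 1 (size w).-1)).
rewrite addKn.
by apply: eq_count.
Qed.

(** Complementation replaces [d] descents by [k - 1 - d]: the binomial is symmetric and the sign
    changes by [(-1)^(k - 1) = (-1)^(k + 1)]. *)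
Lemma phin_twist e k w w' : (0 < k)%N -> pos w -> pos w' -> desc_twist e w w' ->
  phin R k w' = (-1) ^+ (e * k.+1) * phin R k w.
Proof.
move=> k0 pw pw' tw; rewrite !phinE pw pw' (size_desc_twist tw) tw.1.
case: eqP => [kE|_]; last by rewrite !mul0r mulr0.
rewrite -kE in k0 *; rewrite !mul1r sign_nat_exp; case: e {tw}; last by rewrite mul1r.
have wn0 : w != [::] by apply: contraTneq k0 => ->.
have : (size (desc w) < size w)%N := size_desc_lt wn0.
move: (size (desc w)) (size w) => d n dn; rewrite bin_sub; last by lia.
rewrite mulrA; congr (_ / _); rewrite -exprD -signr_odd -[RHS]signr_odd.
by congr (_ ^+ nat_of_bool _); lia.
Qed.

(** The relation is inherited by the blocks of lengths [b], and the exponents [k + 1] add up to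
    [|b| + l(b)]. *)
Lemma phiA_twist e b w w' : pos b -> pos w -> pos w' -> desc_twist e w w' ->
  phiA R b w' = (-1) ^+ (e * (sumn b + size b)) * phiA R b w.
Proof.
elim: b w w' => [|k b IH] w w'.
  move=> _ _ _ [sw _]; rewrite muln0 mul1r.
  by case: w w' sw => [|x w] [|x' w'].
move=> /andP [/= k0 pb] pw pw' [sw tw]; rewrite !phiA_cons sw.
case: leqP => kw; last by rewrite !mul0r mulr0.
move: pw pw'; rewrite (pos_take_drop k w) (pos_take_drop k w').
move=> /andP [pt pd] /andP [pt' pd'].
rewrite (phin_twist (e := e) k0 pt pt'); last first.
  split; first by rewrite !size_takel ?sw.
  move=> j; rewrite size_takel // => jk; rewrite !nth_take ?tw //; lia.
rewrite (IH _ _ pb pd pd'); last first.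
  split; first by rewrite !size_drop ?sw.
  move=> [|j]; rewrite size_drop // => jk; rewrite !nth_drop addnS /=.
  by rewrite -[(k + j)%N]/((k + j).+1.-1) tw //; lia.
have -> : (e * (k + sumn b + (size b).+1) = e * k.+1 + e * (sumn b + size b))%N.
  by case: (e); lia.
by rewrite exprD; ring.
Qed.

(** The coefficient of [r_g] in [phi_b], read off at a word with the descents of that ribbon. *)
Definition rcoef (b g : seq nat) : R := phiA R b (dword (sumn g) (setc g)).

Lemma rexp_dword (c : seq nat -> R) n g : g \in compositions n ->
  rexp c n (dword n (setc g)) = c g.
Proof.
rewrite mem_compositions => /andP [pg /eqP <-].
rewrite /rexp sum_rib size_dword eqxx pos_dword mul1r desc_dword ?valid_setc //.
by rewrite setcK.
Qed.

Lemma phiA_rexp b w : pos b -> phiA R b w = rexp (rcoef b) (sumn b) w.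
Proof.
move=> pb; rewrite /rexp sum_rib; case: eqP => [sw|/eqP sw]; last first.
  by rewrite mul0r phiA_homog.
case: (boolP (pos w)) => pw; last by rewrite mul0r phiA_not_pos.
rewrite mul1r /rcoef -sw comp_of_setK ?valid_desc //.
have := comp_of_set_mem (valid_desc w); rewrite mem_compositions => /andP [_ /eqP ->].
rewrite (@phiA_twist false b w (dword _ _)) ?pos_dword // ?mul1r //.
split=> [|j jw]; first by rewrite size_dword.
by rewrite dword_descP // mem_desc jw.
Qed.

(** The coefficient of [M_g] in [phi_a], as [Fexp_dual] shows: every wall of type [a] has [labn a]
    indexings. *)
Definition Kwall (a g : seq nat) : R :=
  \sum_(B <- walls g | wtype B == a) (labn a)%:R / (fb B)%:R.

(** The weight [s] covers both the constant [1] and the sign; it leaves the sum because all walls of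
    type [a] have the same total size and number of bricks. *)
Lemma IWsum_typeE a (G : seq nat -> R) (s : nat -> nat -> R) :
  IWsum_type a (fun B =>
    s (sumn (wshape B)) (size (wtype B)) / (fb B)%:R * G (wshape B)) =
  s (sumn a) (size a) * \sum_(g <- compositions (sumn a)) Kwall a g * G g.
Proof.
rewrite /IWsum_type big_distrr; apply: eq_bigr => g _ /=.
rewrite /Kwall big_distrl big_distrr /=; rewrite big_seq_cond [RHS]big_seq_cond.
apply: eq_bigr => B /andP [Bg /eqP tB]; rewrite sum_lab_ok.
have -> : sumn (wshape B) = sumn a by rewrite -tB /wshape -sumn_flatten.
move: Bg; rewrite mem_walls => /andP [/eqP -> _]; rewrite tB; ring.
Qed.

Lemma prodn_neq0 b : pos b -> (prodn b)%:R != 0 :> R.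
Proof.
move=> pb; rewrite pnatr_eq0 -lt0n /prodn big_seq.
apply: (big_ind (fun x => 0 < x)%N) => //.
  by move=> x y x0 y0; rewrite muln_gt0 x0.
by move=> i /(allP pb).
Qed.

(** The left side pairs [phi_a] with [h_g]. In the wall expansion of [h_g], duality keeps only walls
    of type [a], and [z_a] over the product of the parts is [labn a]. *)
Lemma dual_hA a d g : is_phi_dual a d -> g \in compositions (sumn a) ->
  \sum_(dl <- compositions (sumn a)) d dl * hA R g (dword (sumn a) (setc dl)) =
  Kwall a g.
Proof.
move=> da ga; under eq_bigr do rewrite hA_walls big_distrr /=.
rewrite exchange_big /= /Kwall [RHS]big_mkcond big_seq [RHS]big_seq.
apply: eq_bigr => B Bg.
have tB : wtype B \in compositions (sumn a).
  move: Bg; rewrite mem_walls => /andP [/eqP sB pB].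
  move: ga; rewrite !mem_compositions -sB => /andP [_ /eqP <-].
  rewrite /wtype sumn_flatten eqxx andbT.
  by elim: B pB {sB} => //= b B IH /andP [pb /IH]; rewrite pos_cat pb.
have /andP [pB /eqP sB] : pos (wtype B) && (sumn (wtype B) == sumn a).
  by rewrite -mem_compositions.
have := da _ tB (rcoef (wtype B)) (fun w => phiA_rexp w pB).
rewrite /pairing => E.
transitivity ((fb B)%:R^-1 / (prodn (wtype B))%:R * ((zc a)%:R * (a == wtype B)%:R) : R).
  rewrite -E big_distrr /= big_seq [RHS]big_seq; apply: eq_bigr => dl.
  by rewrite mem_compositions /rcoef => /andP [_ /eqP ->]; ring.
rewrite eq_sym; case: eqP => [aE|]; last by rewrite !mulr0.
rewrite -aE zcE natrM; have := prodn_neq0 pB => p0.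
have f0 : (fb B)%:R != 0 :> R.
  by rewrite pnatr_eq0 -lt0n; apply: prodn_gt0 => b; apply: fact_gt0.
by rewrite /=; field; rewrite p0 f0.
Qed.

Lemma FmonE g w : pos g ->
  Fmon R g w = ((size w == sumn g) && pos w && sorted leq w)%:R *
     (all (mem (asc w)) (setc g))%:R.
Proof.
move=> pg; rewrite /Fmon -natrM mulnb; congr (nat_of_bool _)%:R.
case: eqP => //= sw; congr (_ && _); apply: eq_in_all => j.
have /andP [_ /allP v] := valid_setc pg => /v.
by rewrite inE mem_asc sw => ->.
Qed.

(** Duality of [M] and [h]: at a weakly increasing word with ascent composition [c], the coefficient
    is the sum of [d g] over [set(g)] contained in [set(c)], which by [hAE] is the pairing with
    [h_c]. *)
Lemma Fexp_dual a d w : is_phi_dual a d ->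
  Fexp d (sumn a) w =
  \sum_(g <- compositions (sumn a)) Kwall a g * Mmon R g w.
Proof.
set n := sumn a => da.
pose G : R := ((size w == n) && pos w && sorted leq w)%:R.
transitivity (G * \sum_(g <- compositions n) Kwall a g * (asc w == setc g)%:R);
  last first.
  rewrite big_distrr /= big_seq [RHS]big_seq; apply: eq_bigr => g.
  rewrite mem_compositions => /andP [pg /eqP sg].
  by rewrite (MmonE _ _ pg) sg -mulnb natrM -/G; ring.
transitivity (G * \sum_(g <- compositions n) d g * (all (mem (asc w)) (setc g))%:R).
  rewrite big_distrr /= /Fexp big_seq [RHS]big_seq; apply: eq_bigr => g.
  rewrite mem_compositions => /andP [pg /eqP sg].
  by rewrite (FmonE _ pg) sg -/G; ring.
rewrite /G; case: eqP => sw; last by rewrite !mul0r.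
congr (_ * _); have va := valid_asc w; rewrite sw in va.
rewrite sum_setc_eq // -(dual_hA da) ?comp_of_set_mem // -/n.
rewrite big_seq [RHS]big_seq; apply: eq_bigr => g.
rewrite mem_compositions => /andP [pg /eqP sg].
have := comp_of_set_mem va; rewrite mem_compositions => /andP [pc /eqP sc].
rewrite hAE // sc size_dword eqxx pos_dword comp_of_setK //.
by rewrite desc_dword // -sg valid_setc.
Qed.

(** Triangularity: the word [aword n (setc g)] only sees compositions whose set is contained in that
    of [g], and those other than [g] have fewer elements. *)
Lemma Fexp_inj n (d d' : seq nat -> R) :
  (forall w, Fexp d n w = Fexp d' n w) ->
  {in compositions n, d =1 d'}.
Proof.
move=> E g; have [m] := ubnP (size (setc g)); elim: m g => // m IH g lt gn.
have /andP [pg /eqP sg] : pos g && (sumn g == n) by rewrite -mem_compositions.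
have := E (aword n (setc g)); rewrite /Fexp.
have FE dl : dl \in compositions n ->
    Fmon R dl (aword n (setc g)) = (all (mem (setc g)) (setc dl))%:R.
  rewrite mem_compositions => /andP [pd /eqP sd].
  rewrite FmonE // size_aword sd eqxx pos_aword sorted_aword mul1r.
  congr (nat_of_bool _)%:R; apply: eq_in_all => j jd.
  have /andP [_ /allP /(_ _ jd)] := valid_setc pd; rewrite sd => jn.
  by rewrite !inE mem_asc size_aword jn aword_ascP.
have g1 : Fmon R g (aword n (setc g)) = 1.
  by rewrite FE // (_ : all _ _ = true) //; apply/allP.
rewrite (bigD1_seq g gn (uniq_compositions n)) /=.
rewrite [in RHS](bigD1_seq g gn (uniq_compositions n)) /= g1 !mulr1.
rewrite big_seq_cond [in RHS]big_seq_cond.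
rewrite (eq_bigr (fun dl => d' dl * Fmon R dl (aword n (setc g)))).
  by move/addIr.
move=> dl /andP [dn dg]; rewrite FE //.
case: (boolP (all _ _)) => [|_]; last by rewrite !mulr0.
move=> /allP sub; rewrite IH //.
have ud : uniq (setc dl) /\ uniq (setc g).
  split; apply: (sorted_uniq ltn_trans ltnn).
    by move: dn; rewrite mem_compositions => /andP [/valid_setc /andP []].
  by have /andP [] := valid_setc pg.
have le : (size (setc dl) <= size (setc g))%N := uniq_leq_size ud.1 sub.
rewrite ltnS in lt; apply: leq_trans lt; rewrite ltn_neqAle le andbT.
apply: contra dg => /eqP sz; apply/eqP; apply: (setc_eq dn gn).
by have [] := uniq_min_size ud.1 sub; rewrite ?sz.
Qed.

(** The [F]-coefficients of [(-1)^(|a| + l(a)) psi(f)], where [f] has coefficients [d]. *)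
Definition twist_dual (a : seq nat) (d : seq nat -> R) : seq nat -> R :=
  fun g => (-1) ^+ (sumn a + size a) * d (compl g).

(** The adjoint of [psi] complements ribbons and so multiplies [phi_b] by [(-1)^(|b| + l(b))]. For
    [b = a] this cancels the sign in [twist_dual]; the other pairings remain [0]. *)
Lemma twist_dual_is_dual a d : is_phi_dual a d -> is_phi_dual a (twist_dual a d).
Proof.
move=> da b ba c bc; have := da b ba c bc.
have /andP [pb /eqP sb] : pos b && (sumn b == sumn a) by rewrite -mem_compositions.
rewrite /pairing -big_compl big_seq => E.
have cE g : g \in compositions (sumn a) ->
    c (compl g) = (-1) ^+ (sumn b + size b) * c g.
  move=> ga; have ca := compl_mem ga.
  rewrite -(rexp_dword c ga) -(rexp_dword c ca) -sb -!bc.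
  rewrite (@phiA_twist true b (dword (sumn b) (setc g))
    (dword _ (setc (compl g))));
    rewrite ?pos_dword ?mul1n //.
  split=> [|j]; rewrite !size_dword // => jn; rewrite !dword_descP //.
  move: ga; rewrite mem_compositions => /andP [pg /eqP sg].
  by rewrite mem_compl // sg -sb jn.
rewrite /twist_dual.
transitivity ((-1) ^+ (sumn a + size a) * (-1) ^+ (sumn b + size b) *
   ((zc a)%:R * (a == b)%:R) : R); last first.
  case: eqP => [->|]; last by rewrite !mulr0.
  by rewrite -expr2 sqrr_sign mul1r.
rewrite -E big_distrr /= big_seq; apply: eq_bigr => g ga.
rewrite cE // mulrACA; congr (_ * _).
by rewrite mulrA -expr2 sqrr_sign mul1r.
Qed.

End Duality.

Theorem mainTheorem20 (R : numFieldType) (alpha : seq nat) (Ha : is_comp alpha) :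
  (forall w, hA R alpha w =
     IWsum_shape alpha (fun B =>
       (fb B)%:R^-1 * (phiA R (wtype B) w / (zc (wtype B))%:R)))
  /\
  (forall w, eA R alpha w =
     IWsum_shape alpha (fun B =>
       (-1) ^+ (sumn (wshape B) - size (wtype B)) / (fb B)%:R
         * (phiA R (wtype B) w / (zc (wtype B))%:R)))
  /\
  (forall d : seq nat -> R, is_phi_dual alpha d ->
     forall w, Fexp d (sumn alpha) w =
       IWsum_type alpha (fun B => (fb B)%:R^-1 * Mmon R (wshape B) w))
  /\
  (forall d : seq nat -> R, is_phi_dual alpha d ->
   forall e : seq nat -> seq nat -> R, is_M_Fexp e ->
     forall w, Fexp d (sumn alpha) w =
       IWsum_type alpha (fun B =>
         (-1) ^+ (sumn (wshape B) - size (wtype B)) / (fb B)%:R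
           * For e (wshape B) w)).
Proof.
split; first by move=> w; apply: hA_indexed_walls.
split; first by move=> w; apply: eA_indexed_walls.
split=> [d da w|d da e eM w].
  rewrite (Fexp_dual _ da) -[LHS]mul1r.
  rewrite -(IWsum_typeE _ (fun g => Mmon R g w) (fun _ _ => 1)).
  by apply: eq_bigr => g _; apply: eq_bigr => B _; apply: eq_bigr => s _; rewrite mul1r.
rewrite (IWsum_typeE _ (fun g => For e g w) (fun m k => (-1) ^+ (m - k))).
rewrite signrB ?size_le_sumn //; set n := sumn alpha.
(* The [F]-coefficients obtained by expanding each [M_g] in the [M]-expansion; [Fexp_inj] identifies
   them with [d]. *)
pose d2 dl := \sum_(g <- compositions n) Kwall R alpha g * e g dl.
have dE : {in compositions n, d =1 d2}.
  apply: Fexp_inj => v; rewrite (Fexp_dual _ da) /Fexp /d2 -/n.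
  under [in RHS]eq_bigr do rewrite big_distrl /=.
  rewrite exchange_big /= big_seq [RHS]big_seq; apply: eq_bigr => g.
  rewrite mem_compositions => /andP [pg /eqP sg].
  rewrite eM // sg /Fexp big_distrr /=.
  by apply: eq_bigr => dl _; rewrite mulrA.
(* Eigenvector property: [d] and its twist are both dual families for [alpha], and [Fexp_dual] gives
   them the same series. *)
transitivity (Fexp (twist_dual alpha d) n w).
  by rewrite (Fexp_dual _ da) (Fexp_dual _ (twist_dual_is_dual da)).
(* Complementing the summation index moves [psi] from the coefficients to the [F], where it turns
   each [M_g] into [For_g]. *)
rewrite /Fexp -big_compl big_seq.
transitivity (\sum_(g <- compositions n)
    (-1) ^+ (n + size alpha) * (d2 g * Fmon R (compl g) w)).
  rewrite [RHS]big_seq; apply: eq_bigr => g gn.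
  by rewrite /twist_dual (complK gn) dE // mulrA.
rewrite -big_distrr /=; congr (_ * _).
under eq_bigr do rewrite /d2 big_distrl /=.
rewrite exchange_big /= big_seq [RHS]big_seq; apply: eq_bigr => g.
rewrite mem_compositions => /andP [pg /eqP sg].
rewrite /For sg big_distrr /=.
by apply: eq_bigr => dl _; rewrite mulrA.
Qed.
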